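(* Let $(V;\mathfrak f,\mathfrak g)$ be a dual-modular instance (as defined in the context) and let $\rho^*\in\mathbb R^V$ be its density vector from the density decomposition. For an allocation $(x,y)\in\mathcal B^{\ge}_{\mathfrak f}\times\mathcal B^{\le}_{\mathfrak g}$ the following three conditions are equivalent: (i) for all $v\in V$, $\frac{x_v}{y_v}=\rho^*_v$; (ii) $(x,y)$ is lexicographically optimal; (iii) $(x,y)$ is locally maximin.
   Context: $V$ is a finite ground set, $n=|V|$. A dual-modular instance $(V;\mathfrak f,\mathfrak g)$ consists of set functions $\mathfrak f,\mathfrak g:2^V\to\mathbb R_{\ge 0}$ with $\mathfrak f(\emptyset)=\mathfrak g(\emptyset)=0$, where $\mathfrak f$ is monotone ($A\subseteq B\Rightarrow \mathfrak f(A)\le\mathfrak f(B)$) and supermodular ($\mathfrak f(A)+\mathfrak f(B)\le\mathfrak f(A\cap B)+\mathfrak f(A\cup B)$ for all $A,B$), and $\mathfrak g$ is submodular ($\mathfrak g(A)+\mathfrak g(B)\ge\mathfrak g(A\cap B)+\mathfrak g(A\cup B)$) and strictly monotone ($A\subsetneq B\Rightarrow\mathfrak g(A)<\mathfrak g(B)$). The functions are normalized so that $\mathfrak f(V)=\mathfrak g(V)=1$. For $h:2^V\to\mathbb R$, $h(S\mid A):=h(S\cup A)-h(A)$. For $x\in\mathbb R^V$, $x(S):=\sum_{u\in S}x_u$. The base contrapolymatroid is $\mathcal B^{\ge}_{\mathfrak f}=\{x\in\mathbb R^V_{\ge0}: x(V)=\mathfrak f(V),\ x(S)\ge\mathfrak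 f(S)\ \forall S\subseteq V\}$ and the base polymatroid is $\mathcal B^{\le}_{\mathfrak g}=\{y\in\mathbb R^V_{\ge0}: y(V)=\mathfrak g(V),\ y(S)\le\mathfrak g(S)\ \forall S\subseteq V\}$. An allocation is a pair $(x,y)\in\mathcal B^{\ge}_{\mathfrak f}\times\mathcal B^{\le}_{\mathfrak g}$ (all coordinates of $y$ are positive by strict monotonicity); the induced density of $v$ is $x_v/y_v$. Density decomposition: set $S_0=\emptyset$; for $i\ge1$, with $S_{<i}=\bigcup_{j<i}S_j$ and $V_i=V\setminus S_{<i}\neq\emptyset$, let $S_i$ be the (unique) inclusion-maximal subset of $V_i$ maximizing $\rho(S\mid S_{<i}):=\mathfrak f(S\mid S_{<i})/\mathfrak g(S\mid S_{<i})$ over nonempty $S\subseteq V_i$; set $\rho_i=\rho(S_i\mid S_{<i})$ and $\rho^*_u=\rho_i$ for $u\in S_i$; stop when $S_i=V_i$. This gives a partition $V=S_1\cup\dots\cup S_k$ and the density vector $\rho^*\in\mathbb R^V$. An allocation is lexicographically optimal if the vector of its induced densities sorted in non-increasing order is lexicographically minimal among all allocations (first minimize the largest density, subject to that the second largest, and so on). An allocation $(x,y)$ is locally maximin if for every $\rho>0$, the set $S^{(\rho)}=\{v\in V: x_v/y_v\ge\rho\}$ satisfies $x(S^{(\rho)})=\mathfrak f(S^{(\rho)})$ and $y(S^{(\rho)})=\mathfrak g(S^{(\rho)})$. *)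

(* Defs.v *)
From mathcomp Require Import all_boot all_order all_algebra reals.

Set Implicit Arguments.
Unset Strict Implicit.
Unset Printing Implicit Defensive.

Import Order.TTheory GRing.Theory Num.Theory.
Local Open Scope ring_scope.

Section DualModular.
Variables (R : realType) (V : finType).
Implicit Types (f g h : {set V} -> R) (x y : V -> R) (A B S T : {set V}).

Definition monotone h := forall A B, A \subset B -> h A <= h B.

Definition strictly_monotone h := forall A B, A \proper B -> h A < h B.

Definition supermodular h :=
  forall A B, h A + h B <= h (A :&: B) + h (A :|: B).

Definition submodular h :=
  forall A B, h (A :&: B) + h (A :|: B) <= h A + h B.

Record dual_modular f g : Prop := DualModular {
  dm_f_ge0 : forall A, 0 <= f A;
  dm_g_ge0 : forall A, 0 <= g A;
  dm_f0 : f set0 = 0;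
  dm_g0 : g set0 = 0;
  dm_f_mono : monotone f;
  dm_f_super : supermodular f;
  dm_g_sub : submodular g;
  dm_g_smono : strictly_monotone g;
  dm_fT : f [set: V] = 1;
  dm_gT : g [set: V] = 1
}.

Definition total x S : R := \sum_(u in S) x u.

Definition base_contrapolymatroid f x : Prop :=
  [/\ forall v, 0 <= x v,
      total x [set: V] = f [set: V]
    & forall S, f S <= total x S].

Definition base_polymatroid g y : Prop :=
  [/\ forall v, 0 <= y v,
      total y [set: V] = g [set: V]
    & forall S, total y S <= g S].

Definition allocation f g x y : Prop :=
  base_contrapolymatroid f x /\ base_polymatroid g y.

Definition density x y (v : V) : R := x v / y v.

Definition marginal h S A : R := h (S :|: A) - h A.

Definition rho f g S A : R := marginal f S A / marginal g S A.

Definition candidate A S : bool := (S != set0) && (S \subset ~: A).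

Definition rho_maximizer f g A S : bool :=
  candidate A S && [forall T, candidate A T ==> (rho f g T A <= rho f g S A)].

(* For a dual-modular instance and A != V the inclusion-maximal maximizer exists
   and is unique, so [pick] returns it; for A = V there is no candidate and the
   value is set0, which makes all blocks after the last one empty. *)
Definition next_block f g A : {set V} :=
  odflt set0 [pick S | maxset (rho_maximizer f g A) S].

(* Blocks are indexed from 0. *)
Definition before f g (i : nat) : {set V} :=
  iter i (fun A => A :|: next_block f g A) set0.

Definition block f g (i : nat) : {set V} := next_block f g (before f g i).

Definition block_density f g (i : nat) : R :=
  rho f g (block f g i) (before f g i).

(* There are at most #|V| nonempty blocks and they partition V, so exactly one
   index is eligible; the default 0 is never used. *)
Definition density_vector f g (u : V) : R :=
  if [pick i : 'I_#|V| | u \in block f g i] is Some i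
  then block_density f g i else 0.

Definition sorted_densities x y : seqlexi R :=
  sort >=%R [seq density x y v | v <- enum V].

(* seqlexi R carries the lexicographic order, which is total, so a minimal
   element is a least one. *)
Definition lex_optimal f g x y : Prop :=
  allocation f g x y /\
  forall x' y', allocation f g x' y' ->
    (sorted_densities x y <= sorted_densities x' y')%O.

Definition locally_maximin f g x y : Prop :=
  allocation f g x y /\
  forall r : R, 0 < r ->
    let S := [set v | r <= density x y v] in
    total x S = f S /\ total y S = g S.

End DualModular.

(* Main.v *)
(* A locally maximin allocation exists: let S maximize the marginal density over
   the contracted ground set, with value r.  Then f <= r g there, with equality at S,
   so the discrete sandwich theorem yields a base y on S with f <= r y and y <= g;
   put x = r y on S, and recurse after contracting S.

   Its level sets {v | x v / y v >= t} are tight for both functions, which forces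
   them to be the unions of the first blocks, so its density vector is rho^*.

   If (x, y) is lexicographically no worse than a locally maximin allocation
   (xs, ys), then by induction down the level sets of (xs, ys) both have the same
   densities and (x, y) is tight on these level sets: on the next level, of density
   t, a larger density of (x, y) would beat xs / ys lexicographically, and otherwise
   x <= t y together with the tightness of (xs, ys) leaves only equalities.  Hence
   locally maximin allocations are exactly the lexicographically optimal ones. *)
Require Import Defs.
From mathcomp Require Import all_boot all_order all_algebra reals.
From mathcomp Require Import lra.

Set Implicit Arguments.
Unset Strict Implicit.
Unset Printing Implicit Defensive.

Import Order.TTheory GRing.Theory Num.Theory.
(* ssrbool also exports a [total]. *)
Import Defs.
Local Open Scope ring_scope.

(** * Separation of a supermodular from a submodular function by a modular one *)

Section Sandwich.
Variables (R : realType) (V : finType).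
Implicit Types (f g z : {set V} -> R) (A B S T W : {set V}).

Lemma total0 (x : V -> R) : total x set0 = 0.
Proof. by rewrite /total big_set0. Qed.

Lemma total1 (x : V -> R) v : total x [set v] = x v.
Proof. by rewrite /total big_set1. Qed.

Lemma totalID (x : V -> R) S T :
  total x T = total x (T :&: S) + total x (T :\: S).
Proof. by rewrite /total -big_setID. Qed.

Lemma totalU (x : V -> R) A B :
  [disjoint A & B] -> total x (A :|: B) = total x A + total x B.
Proof. by move=> dAB; rewrite /total -bigU //; apply: eq_bigl => u; rewrite !inE. Qed.

Lemma eq_total (x x' : V -> R) T :
  {in T, x =1 x'} -> total x T = total x' T.
Proof. by move=> e; apply: eq_bigr => v /e. Qed.

Lemma setI_add v A B : v \notin A -> v \notin B ->
  [/\ (v |: A) :&: B = A :&: B, A :&: (v |: B) = A :&: B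
    & (v |: A) :&: (v |: B) = v |: (A :&: B)].
Proof.
move=> vA vB; split; apply/setP => u; rewrite !inE; have [->|] //= := eqVneq u v.
- by rewrite (negbTE vB) andbF.
- by rewrite (negbTE vA).
Qed.

Lemma setU_add v A B :
  [/\ (v |: A) :|: B = v |: (A :|: B), A :|: (v |: B) = v |: (A :|: B)
    & (v |: A) :|: (v |: B) = v |: (A :|: B)].
Proof.
by split; apply/setP => u; rewrite !inE; case: (u == v); rewrite ?orbT.
Qed.

(** Helly's theorem on the line: the largest [a T] serves as the common point [c]. *)
Lemma exists_between (P : pred {set V}) (a b : {set V} -> R) T0 : P T0 ->
  (forall T U, P T -> P U -> a T <= b U) ->
  exists c, forall T, P T -> a T <= c <= b T.
Proof.
move=> P0 ab.
case: (@Order.TotalTheory.arg_maxP _ _ _ T0 P a P0) => M PM aM.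
by exists (a M) => T PT; apply/andP; split; [exact: aM|exact: ab].
Qed.

(* Frank's discrete sandwich theorem.  To remove v, fix a value c for it and
   project: [f' T = max (f T) (f (v |: T) - c)] stays supermodular and
   [g' T = min (g T) (g (v |: T) - c)] submodular; f <= g, applied to unions and
   intersections, makes the interval of those c with f' <= g' nonempty. *)
Lemma sandwich W f g :
  (forall A B, A \subset W -> B \subset W ->
     f A + f B <= f (A :&: B) + f (A :|: B)) ->
  (forall A B, A \subset W -> B \subset W ->
     g (A :&: B) + g (A :|: B) <= g A + g B) ->
  f set0 = 0 -> g set0 = 0 ->
  (forall A, A \subset W -> f A <= g A) ->
  exists z : V -> R, forall A, A \subset W -> f A <= total z A <= g A.
Proof.
have [n] := ubnP #|W|; elim: n W f g => // n IH W f g.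
have [->|/set0Pn [v vW]] := eqVneq W set0.
  move=> _ _ _ f0 g0 _; exists (fun=> 0) => A; rewrite subset0 => /eqP ->.
  by rewrite total0 f0 g0 lexx.
rewrite ltnS => leWn fS gS f0 g0 fg.
pose W' := W :\ v.
have sW' A : A \subset W' -> [/\ A \subset W, v |: A \subset W & v \notin A].
  by rewrite subsetD1 => /andP[AW vA]; rewrite subUset sub1set vW AW.
have [|T U TW UW|c hc] := @exists_between (fun T => T \subset W')
      (fun T => f (v |: T) - g T) (fun T => g (v |: T) - f T) set0.
- by rewrite /= sub0set.
- have [T1 T2 vT] := sW' _ TW; have [U1 U2 vU] := sW' _ UW.
  have [e1 e2 _] := setI_add vT vU; have [e3 e4 _] := setU_add v T U.
  have := fS _ _ T2 U1; have := gS _ _ T1 U2; rewrite e1 e2 e3 e4.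
  have/fg : T :&: U \subset W by rewrite subIset ?T1.
  have/fg : v |: (T :|: U) \subset W by rewrite -e3 subUset T2 U1.
  lra.
pose f' T := Num.max (f T) (f (v |: T) - c).
pose g' T := Num.min (g T) (g (v |: T) - c).
have fle T : f T <= f' T /\ f (v |: T) - c <= f' T.
  by rewrite /f' !le_max !lexx orbT.
have gge T : g' T <= g T /\ g' T <= g (v |: T) - c.
  by rewrite /g' !ge_min !lexx orbT.
have [|A B AW BW|A B AW BW|||A AW|z hz] := IH W' f' g'.
- by move: leWn; rewrite (cardsD1 v) vW.
- have [A1 A2 vA] := sW' _ AW; have [B1 B2 vB] := sW' _ BW.
  have [e1 e2 e3] := setI_add vA vB; have [e4 e5 e6] := setU_add v A B.
  have [? ?] := fle (A :&: B); have [? ?] := fle (A :|: B).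
  (* Each of the four ways to resolve the two maxima is an instance of supermodularity in which the
     occurrences of [c] balance. *)
  have := fS _ _ A1 B1; have := fS _ _ A2 B1.
  have := fS _ _ A1 B2; have := fS _ _ A2 B2.
  rewrite e1 e2 e3 e4 e5 e6 [f' A]/f' [f' B]/f'.
  by case: (leP (f A)); case: (leP (f B)); lra.
- have [A1 A2 vA] := sW' _ AW; have [B1 B2 vB] := sW' _ BW.
  have [e1 e2 e3] := setI_add vA vB; have [e4 e5 e6] := setU_add v A B.
  have [? ?] := gge (A :&: B); have [? ?] := gge (A :|: B).
  have := gS _ _ A1 B1; have := gS _ _ A2 B1.
  have := gS _ _ A1 B2; have := gS _ _ A2 B2.
  rewrite e1 e2 e3 e4 e5 e6 [g' A]/g' [g' B]/g'.
  by case: (leP (g A)); case: (leP (g B)); lra.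
- by have /andP[] := hc set0 (sub0set _); rewrite /f' f0 g0; case: (leP 0); lra.
- by have /andP[] := hc set0 (sub0set _); rewrite /g' f0 g0; case: (leP 0); lra.
- have [A1 A2 vA] := sW' _ AW; have := fg _ A1; have := fg _ A2.
  have := hc _ AW; rewrite /f' /g'.
  by case: (leP (f A) (_ - c)); case: (leP (g A) (_ - c)); lra.
exists (fun u => if u == v then c else z u) => A AW.
have eqz T : v \notin T ->
    total (fun u => if u == v then c else z u) T = total z T.
  move=> vT; apply: eq_total => u uT; case: eqP => // e.
  by rewrite -e uT in vT.
have [vA|vA] := boolP (v \in A).
  have eA : A = v |: (A :\ v) by rewrite setD1K.
  have vD : v \notin A :\ v by rewrite !inE eqxx.
  have -> : total (fun u => if u == v then c else z u) A = c + total z (A :\ v).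
    by rewrite {1}eA totalU ?disjoints1 // total1 eqxx eqz.
  have /hz/andP[z1 z2] : A :\ v \subset W' by rewrite setSD.
  have [_] := gge (A :\ v); have [_] := fle (A :\ v); rewrite -eA => h1 h2.
  by apply/andP; split; lra.
rewrite eqz //.
have /hz/andP[z1 z2] : A \subset W' by rewrite subsetD1 AW.
have [h1 _] := gge A; have [h2 _] := fle A.
by apply/andP; split; lra.
Qed.

End Sandwich.

(** * Lexicographic comparison through numbers of large entries *)

Section Lexicographic.
Variable R : realType.
Implicit Types (a b : seq R).

Lemma count_ge_sorted0 (s a0 : R) a :
  sorted >=%R (a0 :: a) -> a0 < s -> count (>= s) (a0 :: a) = 0%N.
Proof.
rewrite /sorted (path_sortedE (@ge_trans _ R)) => /andP[/allP ale _] a0s.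
rewrite -(count_pred0 (a0 :: a)); apply: eq_in_count => u ua /=.
apply/negbTE; rewrite -ltNge; move: ua; rewrite inE => /predU1P[-> //|/ale ua].
exact: le_lt_trans ua a0s.
Qed.

(** Equal heads cancel from both counts. At the first difference a smaller head of [a] is
    impossible: if [b0] exceeds [t], the count at [b0] is 0 for [a] and positive for [b]; otherwise
    no entry of [a] exceeds [t]. *)
Lemma lexi_count (t : R) a b :
  sorted >=%R a -> sorted >=%R b ->
  (forall s, t < s -> (count (>= s) b <= count (>= s) a)%N) ->
  (exists2 s, t < s & (count (>= s) b < count (>= s) a)%N) ->
  ~~ ((a : seqlexi R) <= b)%O.
Proof.
elim: a b => [|a0 a IH] [|b0 b] //; try by move=> ? ? ? [s _].
move=> sa sb cle [s ts cs]; rewrite lexi_cons negb_and negb_imply.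
have [ab|//] := leP a0 b0.
have [ba|ba] /= := leP b0 a0; last first.
  have [tb|bt] := ltP t b0.
    by have := cle _ tb; rewrite (count_ge_sorted0 sa) //= lexx.
  by move: cs; rewrite (count_ge_sorted0 sa) //; lra.
have e : a0 = b0 by apply/eqP; rewrite eq_le ab.
subst b0.
apply: IH; [exact: path_sorted sa|exact: path_sorted sb| |].
  by move=> r tr; have := cle r tr; rewrite /= leq_add2l.
by exists s => //; move: cs; rewrite /= ltn_add2l.
Qed.

End Lexicographic.

(** * Existence of a locally maximin allocation *)

Section Existence.
Variables (R : realType) (V : finType) (f g : {set V} -> R).
Hypothesis fg_dual : dual_modular f g.
Implicit Types (A S T : {set V}) (x y : V -> R).

Lemma marginal_supermodular A : supermodular (marginal f ^~ A).
Proof.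
move=> S T; rewrite /marginal /= setUIl setUUl.
by have := dm_f_super fg_dual (S :|: A) (T :|: A); lra.
Qed.

Lemma marginal_submodular A : submodular (marginal g ^~ A).
Proof.
move=> S T; rewrite /marginal /= setUIl setUUl.
by have := dm_g_sub fg_dual (S :|: A) (T :|: A); lra.
Qed.

Lemma marginal0 (h : {set V} -> R) A : marginal h set0 A = 0.
Proof. by rewrite /marginal set0U subrr. Qed.

Lemma marginal_chain (h : {set V} -> R) A S T :
  marginal h (S :|: T) A = marginal h S A + marginal h T (A :|: S).
Proof.
by rewrite /marginal (setUC A) setUCA setUA; lra.
Qed.

Lemma marginal_f_ge0 A S : 0 <= marginal f S A.
Proof. by rewrite subr_ge0 (dm_f_mono fg_dual) // subsetUr. Qed.

Lemma marginal_g_lt A S T : S \proper T -> T \subset ~: A ->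
  marginal g S A < marginal g T A.
Proof.
move=> /properP[ST [v vT vS]] TA.
rewrite ltrD2r; apply: (dm_g_smono fg_dual); apply/properP; split.
  exact: setSU.
exists v; rewrite !inE ?vT // (negbTE vS) /=.
by have := subsetP TA v vT; rewrite inE.
Qed.

Lemma marginal_g_gt0 A S : candidate A S -> 0 < marginal g S A.
Proof.
by move=> /andP[S0 SA]; rewrite -(marginal0 g A) marginal_g_lt // proper0.
Qed.

(** Deleting [v] from [S] strictly lowers the marginal of [g], which still bounds [y] on the rest,
    so [y v] makes up a positive difference. *)
Lemma tight_gt0 A S y : S \subset ~: A -> total y S = marginal g S A ->
  (forall T, T \subset S -> total y T <= marginal g T A) ->
  {in S, forall v, 0 < y v}.
Proof.
move=> SA yS yle v vS.
have := marginal_g_lt (properD1 vS) SA; rewrite -yS.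
have := yle _ (subD1set S v).
by rewrite /total (big_setD1 v vS) /=; lra.
Qed.

(* For rho = 0 the constraint on f is void and the dual of g serves as the lower
   function; otherwise f / rho does. *)
Lemma maximizer_base A S : rho_maximizer f g A S ->
  exists y, total y S = marginal g S A /\ forall T, T \subset S ->
    marginal f T A <= rho f g S A * total y T /\ total y T <= marginal g T A.
Proof.
move=> /andP[cS /forallP mS]; set r := rho f g S A.
have gS := marginal_g_gt0 cS; have [S0 SA] := andP cS.
have fr T : T \subset S -> marginal f T A <= r * marginal g T A.
  move=> TS; have [->|T0] := eqVneq T set0; first by rewrite !marginal0 mulr0.
  have cT : candidate A T by rewrite /candidate T0 (subset_trans TS).
  by have := implyP (mS T) cT; rewrite ler_pdivrMr // marginal_g_gt0.
have frS : marginal f S A = r * marginal g S A by rewrite divfK // gt_eqF.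
have r0 : 0 <= r by rewrite divr_ge0 ?marginal_f_ge0 // ltW.
suff [p [pS p0 pg pgS fp]] : exists p : {set V} -> R,
    [/\ supermodular p, p set0 = 0, forall T, T \subset S -> p T <= marginal g T A,
     p S = marginal g S A & forall T, T \subset S -> marginal f T A <= r * p T].
  have [y hy] := sandwich (W := S) (fun A B _ _ => pS A B)
    (fun B C _ _ => marginal_submodular A B C) p0 (marginal0 g A) pg.
  have /andP[h1 h2] := hy S (subxx S).
  exists y; split=> [|T TS]; first by apply/eqP; rewrite eq_le h2 -pgS.
  have /andP[h ->] := hy T TS; split=> //.
  by rewrite (le_trans (fp T TS)) // ler_wpM2l.
have [rE|rn] := eqVneq r 0.
  exists (fun T => marginal g S A - marginal g (S :\: T) A); split.
  - move=> B C; have := marginal_submodular A (S :\: B) (S :\: C).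
    by rewrite -setDUr -setDIr; lra.
  - by rewrite setD0 subrr.
  - move=> T TS; have := marginal_submodular A T (S :\: T).
    have -> : T :&: (S :\: T) = set0 by apply/setP => u; rewrite !inE; case: (u \in T).
    have -> : T :|: S :\: T = S by rewrite setDE setUIr setUCr setIT; apply/setUidPr.
    by rewrite marginal0; lra.
  - by rewrite setDv marginal0 subr0.
  - by move=> T TS; have := fr T TS; rewrite rE !mul0r.
have rp : 0 < r by rewrite lt_def rn.
exists (fun T => marginal f T A / r); split.
- by move=> B C; rewrite -!mulrDl ler_pM2r ?invr_gt0 // marginal_supermodular.
- by rewrite marginal0 mul0r.
- by move=> T TS; rewrite ler_pdivrMr // mulrC fr.
- by rewrite frS mulrC mulKf.
- by move=> T TS; rewrite mulrC divfK.
Qed.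

(* The analogue, on the instance contracted by A, of being a locally maximin
   allocation. *)
Definition maximin_over A x y : Prop :=
  [/\ forall v, v \notin A -> 0 <= x v /\ 0 < y v,
      forall T, T \subset ~: A ->
        marginal f T A <= total x T /\ total y T <= marginal g T A
    & forall r, let L := [set v in ~: A | r <= density x y v] in
        total x L = marginal f L A /\ total y L = marginal g L A].

Lemma exists_maximin_over A : exists x y, maximin_over A x y.
Proof.
have [n] := ubnP #|~: A|; elim: n A => // n IH A; rewrite ltnS => leAn.
have [->|AT] := eqVneq A setT.
  exists (fun=> 0), (fun=> 0); split=> [v|T|r /=]; first by rewrite inE.
    by rewrite setCT subset0 => /eqP ->; rewrite !total0 !marginal0.
  have -> : [set v in ~: [set: V] | r <= density (fun=> 0) (fun=> 0) v] = set0.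
    by apply/setP => v; rewrite !inE.
  by rewrite !total0 !marginal0.
have cA : candidate A (~: A).
  by rewrite /candidate subxx andbT; apply: contra AT => /eqP e;
     rewrite -(setCK A) e setC0.
(* Any maximizer will do, inclusion-maximal or not: leftovers of the same density return in the
   recursion and join the same level sets. *)
have [S mS] : exists S, rho_maximizer f g A S.
  case: (@Order.TotalTheory.arg_maxP _ _ _ _ (candidate A) (rho f g ^~ A) cA).
  move=> S cS hS; exists S; rewrite /rho_maximizer cS.
  by apply/forallP => T; apply/implyP => /hS.
have [y1 [y1S hy1]] := maximizer_base mS.
have /andP[cS /forallP hS] := mS; have [/set0Pn[w wS] SA] := andP cS.
have gS := marginal_g_gt0 cS.
set r1 := rho f g S A in hy1 hS.
have frS : marginal f S A = r1 * marginal g S A by rewrite divfK // gt_eqF.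
have r10 : 0 <= r1 by rewrite divr_ge0 ?marginal_f_ge0 // ltW.
have y1gt0 : {in S, forall v, 0 < y1 v}.
  by apply: tight_gt0 SA y1S _ => T /hy1[].
have [|x2 [y2 [pos2 bnd2 lev2]]] := IH (A :|: S).
  apply: leq_trans leAn; apply: proper_card; rewrite properEneq setCS subsetUl.
  rewrite andbT; apply/eqP => /setP/(_ w); rewrite !inE wS orbT.
  by have := subsetP SA w wS; rewrite inE => ->.
pose x v := if v \in S then r1 * y1 v else x2 v.
pose y v := if v \in S then y1 v else y2 v.
have xS T : T \subset S -> total x T = r1 * total y1 T.
  move=> TS; rewrite /total mulr_sumr; apply: eq_bigr => v vT.
  by rewrite /x (subsetP TS).
have yS T : T \subset S -> total y T = total y1 T.
  by move=> TS; apply: eq_total => v vT; rewrite /y (subsetP TS).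
have x2T T : T \subset ~: (A :|: S) -> total x T = total x2 T.
  move=> TS; apply: eq_total => v vT; rewrite /x.
  by have := subsetP TS v vT; rewrite !inE negb_or => /andP[_ /negbTE ->].
have y2T T : T \subset ~: (A :|: S) -> total y T = total y2 T.
  move=> TS; apply: eq_total => v vT; rewrite /y.
  by have := subsetP TS v vT; rewrite !inE negb_or => /andP[_ /negbTE ->].
have dS v : v \in S -> density x y v = r1.
  by move=> vS; rewrite /density /x /y vS mulfK // gt_eqF // y1gt0.
exists x, y; split.
- move=> v vA; rewrite /x /y; case: ifPn => vS.
    by have := y1gt0 v vS; split=> //; rewrite mulr_ge0 // ltW.
  by apply: pos2; rewrite !inE negb_or vA.
(* The piece [T :&: S] is bounded before and [T :\: S] after the contraction of [S]; super- and
   submodularity at [T :|: A] and [S :|: A] glue the bounds. *)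
- move=> T TA; rewrite (totalID x S) (totalID y S).
  have sTD : T :\: S \subset ~: (A :|: S).
    by rewrite setCU subsetI (subset_trans _ TA) ?subsetDl // setDE subsetIr.
  have sTI := subsetIr T S.
  rewrite xS // yS // x2T // y2T //.
  have [h1 h2] := hy1 _ sTI; have [h3 h4] := bnd2 _ sTD.
  have eI : T :&: S :|: A = (T :|: A) :&: (S :|: A) by rewrite setUIl.
  have eD : T :\: S :|: (A :|: S) = (T :|: A) :|: (S :|: A).
    by apply/setP => u; rewrite !inE; case: (u \in T); case: (u \in S);
       case: (u \in A).
  have := dm_f_super fg_dual (T :|: A) (S :|: A).
  have := dm_g_sub fg_dual (T :|: A) (S :|: A).
  move: h1 h2 h3 h4; rewrite /marginal eI eD (setUC A S).
  by split; lra.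
move=> r; set L := [set v in _ | _]; cbv zeta.
pose L2 := [set v in ~: (A :|: S) | r <= density x2 y2 v].
have sL2 : L2 \subset ~: (A :|: S) by apply/subsetP => v; rewrite inE => /andP[].
have [x2L y2L] := lev2 r; rewrite -/L2 in x2L y2L.
have LE v : v \in L = if v \in S then r <= r1 else v \in L2.
  rewrite [in LHS]inE; case: ifPn => vS.
    by rewrite dS // (subsetP SA).
  by rewrite !inE negb_or vS andbT /density /x /y (negbTE vS).
have [rr1|r1r] := leP r r1.
  have -> : L = S :|: L2.
    by apply/setP => v; rewrite LE in_setU rr1; case: ifP.
  have dSL : [disjoint S & L2].
    by rewrite disjoints_subset -setCS setCK (subset_trans sL2) // setCS subsetUr.
  rewrite !totalU // xS // yS // x2T // y2T // x2L y2L y1S -frS.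
  by rewrite !marginal_chain.
(* Otherwise [x2 v >= r * y2 v] on the tight set [L2] with [r > r1], and adding [L2] to [S] would
   raise its marginal density above [r1]. *)
have L20 : L2 = set0.
  apply/eqP; apply: contraT => L20.
  have cL : candidate A (S :|: L2).
    rewrite /candidate subUset SA (subset_trans sL2) ?setCS ?subsetUl // !andbT.
    by apply/set0Pn; exists w; rewrite inE wS.
  have := implyP (hS _) cL; rewrite ler_pdivrMr ?marginal_g_gt0 //.
  rewrite !marginal_chain frS => h.
  suff : r1 * marginal g L2 (A :|: S) < marginal f L2 (A :|: S) by lra.
  have cL2 : candidate (A :|: S) L2 by rewrite /candidate L20.
  apply: lt_le_trans (_ : r * marginal g L2 (A :|: S) <= _).
    by rewrite ltr_pM2r // marginal_g_gt0.
  rewrite -x2L -y2L /total mulr_sumr; apply: ler_sum => v.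
  rewrite inE => /andP[vAS]; rewrite ler_pdivlMr //.
  by have [] := pos2 v; rewrite // -in_setC.
have -> : L = set0.
  by apply/setP => v; rewrite LE L20 leNgt r1r !inE; case: ifP.
by rewrite !total0 !marginal0.
Qed.

Lemma exists_locally_maximin : exists x y, locally_maximin f g x y.
Proof.
have [x [y [pos bnd lev]]] := exists_maximin_over set0.
have m0 h T : h set0 = 0 -> marginal h T set0 = h T :> R.
  by move=> h0; rewrite /marginal setU0 h0 subr0.
have mf T := m0 f T (dm_f0 fg_dual); have mg T := m0 g T (dm_g0 fg_dual).
have {}pos v : 0 <= x v /\ 0 < y v by apply: pos; rewrite inE.
have {}bnd T : f T <= total x T /\ total y T <= g T.
  by have := bnd T; rewrite mf mg setC0 subsetT; apply.
have {}lev r : let S := [set v | r <= density x y v] in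
    total x S = f S /\ total y S = g S.
  have /= := lev r; rewrite mf mg; set L := [set v in _ | _].
  suff -> : L = [set v | r <= density x y v] by [].
  by apply/setP => v; rewrite !inE.
(* Level 0 is the whole ground set, so its tightness yields the two base equations. *)
have lev0 : [set v | 0 <= density x y v] = setT.
  by apply/setP => v; have [? ?] := pos v; rewrite !inE divr_ge0 // ltW.
have := lev 0; rewrite lev0 => -[xT yT].
exists x, y; split=> [|r _]; last exact: lev.
split; split=> // z.
- by case: (pos z).
- by case: (bnd z).
- by case: (pos z) => _ /ltW.
- by case: (bnd z).
Qed.

End Existence.

(** * Level sets of densities and blocks of the decomposition *)

Section Levels.
Variables (R : realType) (V : finType) (f g : {set V} -> R).
Hypothesis fg_dual : dual_modular f g.
Implicit Types (A S T : {set V}) (x y : V -> R).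

Definition level x y (r : R) : {set V} := [set v | r <= density x y v].

Definition tight x y A : Prop := total x A = f A /\ total y A = g A.

(** These are the empty set and the level sets of the density, described without a threshold. *)
Definition upper x y A : Prop :=
  forall u v, u \in A -> v \notin A -> density x y v < density x y u.

Lemma allocation_gt0 x y : allocation f g x y -> forall v, 0 < y v.
Proof.
move=> [_ [_ yT yle]] v.
apply: (@tight_gt0 _ _ _ _ fg_dual set0 setT y) => //; first by rewrite setC0.
  by rewrite /marginal setU0 (dm_g0 fg_dual) subr0 yT.
by move=> T _; rewrite /marginal setU0 (dm_g0 fg_dual) subr0; exact: yle.
Qed.

Lemma density_ge0 x y : allocation f g x y -> forall v, 0 <= density x y v.
Proof.
move=> xy v; have y0 := allocation_gt0 xy v; case: xy => -[x0 _ _] _.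
by rewrite divr_ge0 // ltW.
Qed.

Lemma tight_level x y r : locally_maximin f g x y -> tight x y (level x y r).
Proof.
move=> [xy lm]; have [r0|r0] := ltP 0 r; first exact: (lm r r0).
(* Local maximinity speaks of positive thresholds; at the others the level set is everything, and
   the base equations give tightness. *)
have -> : level x y r = setT.
  by apply/setP => v; rewrite !inE (le_trans r0) ?(density_ge0 xy).
by case: xy => -[_ ? _] [].
Qed.

Lemma total_le_density x y T t : (forall v, 0 < y v) ->
  {in T, forall v, density x y v <= t} -> total x T <= t * total y T.
Proof.
move=> y0 dt; rewrite /total mulr_sumr; apply: ler_sum => v vT.
by rewrite -ler_pdivrMr //; exact: dt.
Qed.

(** The elements other than [v] contribute at most [t] times their share of [y], so [x v] has to be
    at least [t * y v]. *)
Lemma total_eq_density x y T t : (forall v, 0 < y v) ->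
  {in T, forall v, density x y v <= t} -> t * total y T <= total x T ->
  {in T, forall v, density x y v = t}.
Proof.
move=> y0 dt le v vT; apply/eqP; rewrite eq_le dt //= ler_pdivlMr //.
have sTv : {in T :\ v, forall u, density x y u <= t}.
  by move=> u /setD1P[_]; exact: dt.
have := total_le_density y0 sTv; move: le.
by rewrite /total !(big_setD1 v vT) /= mulrDr; lra.
Qed.

Lemma total_density_eq x y T t : (forall v, 0 < y v) ->
  {in T, forall v, density x y v = t} -> total x T = t * total y T.
Proof.
move=> y0 dt; rewrite /total mulr_sumr; apply: eq_bigr => v vT.
by rewrite -(dt v vT) divfK // gt_eqF.
Qed.

Lemma upper_level x y r : upper x y (level x y r).
Proof.
by move=> u v; rewrite !inE -ltNge => ru vr; exact: lt_le_trans vr ru.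
Qed.

(** Here [t] is the largest density outside [A], and [S] collects the elements outside [A] that
    attain it. *)
Lemma next_level x y A : upper x y A -> A != setT ->
  exists t S, [/\ S != set0, [disjoint A & S], A :|: S = level x y t,
    {in S, forall v, density x y v = t}
    & forall v, v \notin A -> density x y v <= t /\ (v \notin S -> density x y v < t)].
Proof.
move=> uA; rewrite -subTset => /subsetPn[w0 _ w0A].
case: (@Order.TotalTheory.arg_maxP _ _ _ w0 (fun v => v \notin A) (density x y)) => //.
move=> w wA wmax; exists (density x y w).
exists [set v | (v \notin A) && (density x y v == density x y w)]; split.
- by apply/set0Pn; exists w; rewrite inE wA eqxx.
- by rewrite disjoints_subset; apply/subsetP => v vA; rewrite !inE vA.
- apply/setP => v; rewrite !inE; have [vA|vA] /= := boolP (v \in A).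
    by rewrite ltW // uA.
  by rewrite eq_le; have /= -> := wmax v vA.
- by move=> v; rewrite inE => /andP[_ /eqP].
move=> v vA; split; first exact: wmax.
by rewrite inE vA lt_neqAle => -> /=; exact: wmax.
Qed.

Lemma marginal_le_density x y A T t : allocation f g x y -> tight x y A ->
  0 <= t -> T \subset ~: A -> {in T, forall v, density x y v <= t} ->
  [/\ marginal f T A <= total x T, total x T <= t * total y T
    & total y T <= marginal g T A].
Proof.
move=> xy [xA yA] t0 TA dt; have y0 := allocation_gt0 xy.
have dTA : [disjoint T & A] by rewrite disjoints_subset.
case: xy => -[_ _ fx] [_ _ yg].
rewrite /marginal -xA -yA; split; last 1 first.
- by have := yg (T :|: A); rewrite totalU //; lra.
- by have := fx (T :|: A); rewrite totalU //; lra.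
exact: total_le_density.
Qed.

(** For [T] disjoint from [A], [marginal f T A <= total x T <= t * total y T <= t * marginal g T A],
    with equality at [S] because [A] and [A :|: S] are tight. Equality for another [T] forces
    density [t] throughout [T], hence [T \subset S]. *)
Lemma next_block_level x y A S t : locally_maximin f g x y -> tight x y A ->
  S != set0 -> [disjoint A & S] -> A :|: S = level x y t ->
  {in S, forall v, density x y v = t} ->
  (forall v, v \notin A -> density x y v <= t /\ (v \notin S -> density x y v < t)) ->
  next_block f g A = S /\ rho f g S A = t.
Proof.
move=> lm tA S0 dAS AS dS dN; have [xy _] := lm.
have y0 := allocation_gt0 xy.
have dSA : [disjoint S & A] by rewrite disjoint_sym.
have cS : candidate A S by rewrite /candidate S0 -disjoints_subset.
have t0 : 0 <= t.
  by case/set0Pn: S0 => v /dS <-; exact: density_ge0 xy v.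
have rS : rho f g S A = t.
  have := marginal_g_gt0 fg_dual cS; have := tight_level t lm.
  rewrite -AS setUC /tight => -[e1 e2]; case: tA => e3 e4.
  rewrite /rho /marginal -e1 -e2 -e3 -e4 !totalU // !addrK => yS.
  by rewrite (total_density_eq y0 dS) mulfK // gt_eqF.
have dT T : T \subset ~: A -> {in T, forall v, density x y v <= t}.
  move=> TA v vT; have vA : v \notin A by rewrite -in_setC (subsetP TA).
  by have [] := dN v vA.
have rT T : candidate A T -> rho f g T A <= t.
  move=> cT; have /andP[_ TA] := cT; rewrite ler_pdivrMr ?(marginal_g_gt0 fg_dual) //.
  have [h1 h2 h3] := marginal_le_density xy tA t0 TA (dT T TA).
  by rewrite (le_trans h1) // (le_trans h2) // ler_wpM2l.
have mS : rho_maximizer f g A S.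
  by rewrite /rho_maximizer cS; apply/forallP => T; apply/implyP => /rT; rewrite rS.
have maxS T : rho_maximizer f g A T -> T \subset S.
  move=> /andP[cT /forallP/(_ S)/implyP/(_ cS)]; rewrite rS => tr.
  have {tr}rE : rho f g T A = t by apply/eqP; rewrite eq_le rT.
  have /andP[_ TA] := cT.
  have [h1 h2 h3] := marginal_le_density xy tA t0 TA (dT T TA).
  have dTt : {in T, forall v, density x y v = t}.
    apply: total_eq_density y0 (dT T TA) _; apply: le_trans h1.
    apply: (@le_trans _ _ (t * marginal g T A)); first exact: ler_wpM2l.
    by rewrite -rE divfK // gt_eqF // (marginal_g_gt0 fg_dual).
  apply/subsetP => v vT; apply: contraT => vS.
  have vA : v \notin A by rewrite -in_setC (subsetP TA).
  by have [_ /(_ vS)] := dN v vA; rewrite dTt // ltxx.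
split=> //; rewrite /next_block; case: pickP => [T|/(_ S)] /=.
  by move=> /maxsetP[mT /(_ S mS) h]; rewrite h // maxS.
move=> /negP; case; apply/maxsetP; split=> // T mT ST.
by apply/eqP; rewrite eqEsubset ST maxS.
Qed.

Lemma next_blockT : next_block f g setT = set0.
Proof.
rewrite /next_block; case: pickP => //= S /maxsetP[/andP[/andP[_ +] _] _].
by rewrite setCT subset0 => /eqP.
Qed.

(** Invariant of the greedy construction. The last clause counts at least one new element per step,
    so the blocks exhaust [V] within [#|V|] steps. *)
Lemma before_level x y i : locally_maximin f g x y ->
  [/\ upper x y (before f g i), tight x y (before f g i),
      {in block f g i, forall v, density x y v = block_density f g i}
    & (i <= #|before f g i|)%N \/ before f g i = setT].
Proof.
move=> lm.
have step A : upper x y A -> tight x y A ->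
    [/\ {in next_block f g A, forall v, density x y v = rho f g (next_block f g A) A},
       upper x y (A :|: next_block f g A), tight x y (A :|: next_block f g A)
     & A = setT \/ (#|A| < #|A :|: next_block f g A|)%N].
  move=> uA tA; have [->|AT] := eqVneq A setT.
    rewrite next_blockT setU0; split; last by left.
    - by move=> v; rewrite inE.
    - by move=> u v; rewrite !inE.
    have [[[_ xT _] [_ yT _]] _] := lm; by split.
  have [t [S [S0 dAS AS dS dN]]] := next_level uA AT.
  have [-> ->] := next_block_level lm tA S0 dAS AS dS dN.
  split=> //; rewrite ?AS; [exact: upper_level|exact: tight_level|right].
  by rewrite -AS -subn_gt0 cardsU (disjoint_setI0 dAS) cards0 subn0 addKn card_gt0.
elim: i => [|i [uA tA _ cA]].
  have u0 : upper x y set0 by move=> u v; rewrite inE.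
  have t0 : tight x y set0.
    by rewrite /tight !total0 (dm_f0 fg_dual) (dm_g0 fg_dual).
  by have [] := step _ u0 t0; split=> //; left.
have [_ uB tB cB] := step _ uA tA; have [dB _ _ _] := step _ uB tB.
split=> //; case: cB => cB.
  by right; rewrite /before /= -/(before f g i) cB setTU.
case: cA => cA; last by right; rewrite /before /= -/(before f g i) cA setTU.
by left; exact: leq_ltn_trans cA cB.
Qed.

Lemma mem_before u n : u \in before f g n -> exists2 i, (i < n)%N & u \in block f g i.
Proof.
elim: n => [|n IH]; first by rewrite inE.
rewrite /before /= -/(before f g n) in_setU => /orP[/IH[i lin ui]|un].
  by exists i => //; exact: ltnW.
by exists n.
Qed.

Lemma locally_maximin_density x y : locally_maximin f g x y ->
  density x y =1 density_vector f g.
Proof.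
move=> lm u; rewrite /density_vector; case: pickP => [i ui|none].
  by have [_ _ -> ] := before_level i lm.
(* The first [#|V|] blocks cover [V], so the default value 0 is never reached. *)
have [_ _ _ cT] := before_level #|V| lm.
have bT : before f g #|V| = setT.
  case: cT => // c; by apply/eqP; rewrite eqEcard subsetT cardsT.
have [i iV ui] : exists2 i, (i < #|V|)%N & u \in block f g i.
  by apply: mem_before; rewrite bT inE.
by have := none (Ordinal iV); rewrite /= ui.
Qed.

(** * Lexicographic comparison with a locally maximin allocation *)

Lemma sorted_sorted_densities x y : sorted >=%R (sorted_densities x y).
Proof. by apply: sort_sorted => a b; exact: le_total. Qed.

Lemma count_sorted_densities x y s :
  count (>= s) (sorted_densities x y) = #|level x y s|.
Proof.
rewrite /sorted_densities count_sort count_map -sum1_count big_enum_cond /=.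
by rewrite -sum1_card; apply: eq_bigl => v; rewrite inE.
Qed.

Lemma lex_le_locally_maximin xs ys x y : locally_maximin f g xs ys ->
  allocation f g x y ->
  ((sorted_densities x y : seqlexi R) <= sorted_densities xs ys)%O ->
  density x y =1 density xs ys /\ locally_maximin f g x y.
Proof.
move=> lm xy le; have y0 := allocation_gt0 xy.
have [xys _] := lm; have ys0 := allocation_gt0 xys.
(* From an upper set [A] on which both allocations are tight and agree in density, the levels of
   [(xs, ys)] are peeled off one at a time down to level [r]. *)
suff key n A : (#|~: A| < n)%N -> upper xs ys A -> tight xs ys A -> tight x y A ->
    {in A, density x y =1 density xs ys} ->
    forall r, A \subset level xs ys r ->
      tight x y (level xs ys r) /\ {in level xs ys r, density x y =1 density xs ys}.
  have h r : tight x y (level xs ys r) /\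
             {in level xs ys r, density x y =1 density xs ys}.
    apply: (key _ set0 (leqnn _)); rewrite ?sub0set //; last first.
    - by move=> v; rewrite inE.
    - by rewrite /tight !total0 (dm_f0 fg_dual) (dm_g0 fg_dual).
    - by rewrite /tight !total0 (dm_f0 fg_dual) (dm_g0 fg_dual).
    by move=> u v; rewrite inE.
  have dE : density x y =1 density xs ys.
    by move=> v; apply: (h 0).2; rewrite inE (density_ge0 xys).
  split=> //; split=> // r _ /=.
  suff -> : [set v | r <= density x y v] = level xs ys r by exact: (h r).1.
  by apply/setP => v; rewrite !inE dE.
elim: n A => // n IH A; rewrite ltnS => leAn uA tsA tA dA r Ar.
have [<- //|/eqP nAr] := eqVneq A (level xs ys r).
have [w wr wA] : exists2 w, w \in level xs ys r & w \notin A.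
  by apply/subsetPn; apply: contra_notN nAr => rA; apply/eqP; rewrite eqEsubset Ar.
have AT : A != setT by apply: contraNneq wA => ->; rewrite inE.
have [t [S [S0 dAS AS dS dN]]] := next_level uA AT.
have rt : r <= t.
  by have [wt _] := dN w wA; move: wr; rewrite inE => /le_trans; apply.
(* Above [t] the levels of [(xs, ys)] lie in [A], where the densities agree, so [(x, y)] never
   counts less there; a [v] outside [A] of density above [t] would make one count strictly larger,
   against [le]. *)
have dt v : v \notin A -> density x y v <= t.
  move=> vA; rewrite leNgt; apply/negP => tv.
  have sub s : t < s -> level xs ys s \subset A.
    move=> ts; apply/subsetP => u; rewrite inE => su; apply: contraT => uA'.
    by have [ut _] := dN u uA'; have := lt_le_trans ts (le_trans su ut); rewrite ltxx.
  have sub' s : t < s -> level xs ys s \subset level x y s.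
    move=> ts; apply/subsetP => u us; have uA' := subsetP (sub s ts) u us.
    by rewrite inE dA //; rewrite inE in us.
  move: le; apply/negP; apply: (@lexi_count _ t); try exact: sorted_sorted_densities.
    by move=> s ts; rewrite !count_sorted_densities subset_leq_card // sub'.
  exists (density x y v) => //; rewrite !count_sorted_densities proper_card //.
  apply/properP; split; first exact: sub'.
  by exists v; [rewrite inE|apply: contra vA; apply/subsetP/sub].
have dS' : {in S, forall v, density x y v <= t}.
  by move=> v vS; apply: dt; rewrite (disjointFl dAS).
have t0 : 0 <= t by case/set0Pn: S0 => v /dS <-; exact: density_ge0.
have [txs tys] := tight_level t lm; rewrite -AS !totalU // in txs tys.
have xsS := total_density_eq ys0 dS.
have xS := total_le_density y0 dS'.
have [[_ xT fx] [_ yT yg]] := xy.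
have := fx (A :|: S); have := yg (A :|: S); rewrite !totalU // => yAS xAS.
case: (tA) => xA yA; case: tsA => xsA ysA.
(* Tightness gives [y(S) <= ys(S)] and [t ys(S) = xs(S) <= x(S)]; with [x(S) <= t y(S)] the chain
   closes into equalities. *)
have yS : total y S <= total ys S by lra.
have tyS : t * total y S <= t * total ys S by exact: ler_wpM2l.
have tB : tight x y (A :|: S).
  (* A positive [t] cancels, giving [y(S) = ys(S)]. For [t = 0] the level set is everything, and
     tightness is the base equations. *)
  have [tp|tn] := ltP 0 t.
    have : total ys S <= total y S by rewrite -(ler_pM2l tp); lra.
    by rewrite /tight !totalU //; split; lra.
  suff -> : A :|: S = setT by split.
  by rewrite AS; apply/setP => v; rewrite !inE (le_trans tn) ?density_ge0.
apply: (IH (A :|: S)) => //.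
- apply: leq_trans leAn; apply: proper_card; rewrite properEneq setCS subsetUl andbT.
  have /set0Pn[v vS] := S0; apply/eqP => /setP/(_ v).
  by rewrite !inE vS orbT (disjointFl dAS).
- by rewrite AS; exact: upper_level.
- by rewrite AS; exact: tight_level.
- move=> v; rewrite in_setU => /orP[/dA //|vS]; rewrite (dS v vS).
  by apply: total_eq_density y0 dS' _ v vS; lra.
by rewrite AS; apply/subsetP => v; rewrite !inE; exact: le_trans.
Qed.

Lemma eq_sorted_densities x y x' y' : density x y =1 density x' y' ->
  sorted_densities x y = sorted_densities x' y'.
Proof. by move=> e; rewrite /sorted_densities (eq_map e). Qed.

(** A strictly better allocation is in particular no worse, so it has the same densities and the
    same sorted vector, a contradiction. *)
Lemma locally_maximin_lex_optimal x y :
  locally_maximin f g x y -> lex_optimal f g x y.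
Proof.
move=> lm; have [xy _] := lm; split=> // x' y' xy'.
rewrite leNgt; apply/negP => lt.
have [/eq_sorted_densities e _] := lex_le_locally_maximin lm xy' (ltW lt).
by rewrite e ltxx in lt.
Qed.

End Levels.

Theorem theorem1p1 (R : realType) (V : finType) (f g : {set V} -> R)
    (fg_dual : dual_modular f g) (x y : V -> R) (xy_alloc : allocation f g x y) :
  [<-> forall v : V, (x v / y v)%R = density_vector f g v;
       lex_optimal f g x y;
       locally_maximin f g x y].
Proof.
have [xs [ys lm]] := exists_locally_maximin fg_dual.
tfae.
(* Both [(x, y)] and the reference [(xs, ys)] have densities [density_vector f g], so they tie
   lexicographically, and a tie already makes [(x, y)] locally maximin. *)
- move=> d; apply: locally_maximin_lex_optimal => //.
  apply: (lex_le_locally_maximin fg_dual lm xy_alloc _).2.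
  rewrite (@eq_sorted_densities _ _ x y xs ys) // => v.
  by rewrite (locally_maximin_density fg_dual lm) /density d.
- move=> [_ opt]; have [xys _] := lm.
  exact: (lex_le_locally_maximin fg_dual lm xy_alloc (opt _ _ xys)).2.
- by move=> lmxy v; exact: (locally_maximin_density fg_dual lmxy v).
Qed.
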